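(* Let $0\le i\le m\le n$ and let $\Delta_\succ$ be the reverse lexicographic triangulation of $\mathcal P(m,n)=\{e_a\oplus f_b:1\le a\le m,\,1\le b\le n\}\subset\mathbb R^m\oplus\mathbb R^n$ with respect to a total order of the points (identified with variables $x_{ab}\leftrightarrow e_a\oplus f_b$) in which $x_{11}\prec x_{22}\prec\cdots\prec x_{ii}$ and all remaining variables are larger than $x_{ii}$. After removing the cone points $x_{11},\dots,x_{ii}$ from $\Delta_\succ$, the remaining simplicial complex is an $(m+n-i-2)$-dimensional ball if $m<n$, or if $m=n$ and $i<m$; and it is an $(n-2)$-dimensional sphere if $i=m=n$.
   Context: $e_a$, $f_b$ are standard unit vectors. Reverse lexicographic triangulation of a point configuration $\mathcal A=\{a_1\succ\cdots\succ a_N\}$: if $F_1,\dots,F_k$ are the facets of $\operatorname{conv}(\mathcal A)$ not containing $a_N$, the maximal simplices of $\Delta_\succ(\mathcal A)$ are the sets $G\cup\{a_N\}$ with $G$ a maximal simplex of $\Delta_\succ(\mathcal A\cap F_i)$ (recursively, with the induced order). Removing vertices $v_1,\dots,v_r$ that are cone points (lie in every facet) means passing to the complex of faces not containing any $v_j$ (restriction to the other vertices); balls and spheres are understood up to homeomorphism of geometric realizations. *)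

(* Defs.v *)
From HB Require Import structures.
From mathcomp Require Import all_boot all_order all_algebra.
From mathcomp Require Import all_classical all_reals all_analysis.

Set Implicit Arguments.
Unset Strict Implicit.
Unset Printing Implicit Defensive.

Import Order.TTheory GRing.Theory Num.Theory.
Import numFieldNormedType.Exports.
Local Open Scope classical_set_scope.
Local Open Scope ring_scope.

Section PointConfig.
Variables (R : realType) (d : nat) (I : finType) (p : I -> 'rV[R]_d).

(* affine dimension of the convex hull of the points indexed by S;
   the empty set has dimension -1 *)
Definition affdim (S : {set I}) : int :=
  match [pick x in S] with
  | None => (-1)%R
  | Some x0 =>
      (\rank (\matrix_(k < #|I|)
                (if enum_val k \in S then p (enum_val k) - p x0 else 0)))%:Z
  end.

Definition dotp (u v : 'rV[R]_d) : R := \sum_(j < d) u 0 j * v 0 j.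

(* F is (the point set of) a face of conv(A): the intersection of A with a
   supporting hyperplane (c = 0, b = 0 gives A itself; b large gives the
   empty face) *)
Definition is_face (A F : {set I}) : Prop :=
  exists (c : 'rV[R]_d) (b : R),
    (forall x, x \in A -> dotp (p x) c <= b) /\
    F = [set x in A | dotp (p x) c == b].

Definition is_facet (A F : {set I}) : Prop :=
  is_face A F /\ affdim F = affdim A - 1.

(* The total order on the points is given by an injective rank r:
   x precedes y  iff  r x < r y.  revlex_max A G  means that G is a maximal
   simplex of the reverse lexicographic triangulation of the subconfiguration
   A (with the induced order): G = G' u {a_N} with a_N the smallest point of
   A, and G' a maximal simplex of the revlex triangulation of A cap F for a
   facet F of conv(A) not containing a_N.  The empty configuration has the
   single maximal simplex set0. *)
Variable r : I -> nat.

Inductive revlex_max : {set I} -> {set I} -> Prop :=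
| RL_nil : revlex_max finset.set0 finset.set0
| RL_cone (A F G : {set I}) (aN : I) :
    aN \in A ->
    (forall b, b \in A -> (r aN <= r b)%N) ->
    is_facet A F -> aN \notin F ->
    revlex_max F G ->
    revlex_max A (aN |: G).

Definition revlex_face_avoiding (V sigma : {set I}) : Prop :=
  exists G, revlex_max (finset.setTfor I) G /\ sigma \subset G /\ (forall x, x \in sigma -> x \notin V).

End PointConfig.

(* geometric realization of an abstract simplicial complex on vertex set I
   (given by its set of faces K), vertices sent to the standard basis of
   R^#|I| *)
Section Realization.
Variables (R : realType) (I : finType).

Definition std_simplex (sigma : {set I}) : set 'rV[R]_#|I| :=
  [set t | (forall k, 0 <= t 0 k) /\
           (forall k, enum_val k \notin sigma -> t 0 k = 0) /\
           \sum_k t 0 k = 1].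

Definition realization (K : {set I} -> Prop) : set 'rV[R]_#|I| :=
  [set t | exists sigma, K sigma /\ std_simplex sigma t].
End Realization.

Definition homeomorphic (U V : topologicalType) (A : set U) (B : set V) : Prop :=
  exists (f : U -> V) (g : V -> U),
    {within A, continuous f} /\ {within B, continuous g} /\
    (forall x, A x -> B (f x)) /\ (forall y, B y -> A (g y)) /\
    (forall x, A x -> g (f x) = x) /\ (forall y, B y -> f (g y) = y).

Definition unit_ball (R : realType) (k : nat) : set 'rV[R]_k :=
  [set x | \sum_(j < k) x 0 j ^+ 2 <= 1].

(* Euclidean unit sphere in R^k (a (k-1)-dimensional sphere; empty if k = 0) *)
Definition unit_sphere (R : realType) (k : nat) : set 'rV[R]_k :=
  [set x | \sum_(j < k) x 0 j ^+ 2 = 1].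

(* The configuration P(m,n) = { e_a (+) f_b } in R^m (+) R^n, indices      *)
(* 0-based: (a,b) : 'I_m * 'I_n stands for x_{a+1,b+1}.                     *)
Definition Pmn (R : realType) (m n : nat) (x : 'I_m * 'I_n) : 'rV[R]_(m + n) :=
  \row_j ((j == lshift n x.1)%:R + (j == rshift m x.2)%:R).

(* x is one of the variables x_11, ..., x_ii (0-based: (k,k) with k < i) *)
Definition is_cone_var (m n i : nat) (x : 'I_m * 'I_n) : bool :=
  (nat_of_ord x.1 == nat_of_ord x.2) && (x.1 < i)%N.

Definition cone_vars (m n i : nat) : {set 'I_m * 'I_n} :=
  finset.finset (fun x => is_cone_var i x).

Definition revlex_minus_cone (R : realType) (m n i : nat)
    (r : 'I_m * 'I_n -> nat) : set 'rV[R]_#|{: 'I_m * 'I_n}| :=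
  @realization R _ (revlex_face_avoiding (@Pmn R m n) r (cone_vars m n i)).

(* Main.v *)
Require Import Defs.
From HB Require Import structures.
From mathcomp Require Import all_boot all_order all_algebra.
From mathcomp Require Import all_classical all_reals all_analysis.
From mathcomp Require Import lra zify ring.
Import numFieldNormedType.Exports.

(** The faces of the triangulation are the sets of cells of the [m x n] grid that
    contain no two cells [(a, b')], [(a', b)] both larger than the corner
    [(a, b)]: a face of the product of simplices is closed under exchanging
    columns, and conversely the smallest cell [(a, b)] of a subgrid is the apex
    over the facets obtained by deleting row [a] or column [b].  Nonnegative
    matrices with such a support are determined by their margins, and any
    margins of equal total are realized by the greedy algorithm.

    Hence, once [x_11, ..., x_ii] are removed, the realization is the set of
    margins [(x, y)] with [x_l y_l = 0] for [l <= i].  Recording [x_l - y_l] for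
    [l <= i], the other [x_l], and the other [- y_l], this is the section
    [sum |w_l| = 2] of a convex cone in the hyperplane [sum w_l = 0] of
    [R^(m+n-i)]; the cone is the hyperplane itself if [i = m = n], which yields a
    sphere, and otherwise it is cut out by sign conditions on some coordinates
    and has an interior point, which yields a ball. *)

Set Implicit Arguments.
Unset Strict Implicit.

(** * Transport matrices with noncrossing support *)

Section Transport.
Import Order.TTheory GRing.Theory Num.Theory.
Local Open Scope ring_scope.
Variables (R : realType) (I J : finType) (r : I * J -> nat).

(** For the minor on rows [a, a'] and columns [b, b'], the excluded pair is the monomial without the
    smallest of the four variables, that is, the reverse lexicographic initial monomial. *)
Definition noncrossing (P : I * J -> bool) : Prop :=
  forall a b a' b', P (a, b') -> P (a', b) ->
    (r (a, b) < r (a, b'))%N -> (r (a, b) < r (a', b))%N -> False.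

(** Here [g] runs along a row or a column. If [t] vanished beyond [g k0], it would be at most [t']
    termwise and strictly smaller at [k0], against the equal sums. *)
Lemma later_support (K : finType) (g : K -> I * J) (t t' : I * J -> R) k0 :
  injective r -> injective g -> (forall x, 0 <= t' x) ->
  (forall y, (r y < r (g k0))%N -> t y = t' y) -> t (g k0) < t' (g k0) ->
  \sum_k t (g k) = \sum_k t' (g k) ->
  exists2 k, t (g k) != 0 & (r (g k0) < r (g k))%N.
Proof.
move=> rinj ginj t0' before tlt eqs.
have [/existsP[k /andP[]]|/existsPn none] :=
  boolP [exists k, (t (g k) != 0) && (r (g k0) < r (g k))%N].
  by exists k.
suff : \sum_k t (g k) < \sum_k t' (g k) by rewrite eqs ltxx.
rewrite (bigD1 k0) //= [ltRHS](bigD1 k0) //=; apply: ltr_leD => //.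
apply: ler_sum => k nk; have := none k.
case: (ltngtP (r (g k0)) (r (g k))) => [_|lt_k _|/rinj/ginj eq_k].
- by rewrite andbT negbK => /eqP ->.
- by rewrite before.
- by rewrite eq_k eqxx in nk.
Qed.

(** Suppose the matrices agree before [x]. A strict inequality at [x] would give the smaller one
    later support in both the row and the column of [x], which is a crossing with corner [x]. Using
    this in both directions gives equality at [x]. *)
Lemma noncrossing_transport_unique (t t' : I * J -> R) :
  injective r ->
  (forall x, 0 <= t x) -> (forall x, 0 <= t' x) ->
  noncrossing (fun x => t x != 0) -> noncrossing (fun x => t' x != 0) ->
  (forall a, \sum_b t (a, b) = \sum_b t' (a, b)) ->
  (forall b, \sum_a t (a, b) = \sum_a t' (a, b)) ->
  t =1 t'.
Proof.
move=> rinj.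
have key (s s' : I * J -> R) x : (forall y, (r y < r x)%N -> s y = s' y) ->
    (forall x, 0 <= s' x) -> noncrossing (fun x => s x != 0) ->
    (forall a, \sum_b s (a, b) = \sum_b s' (a, b)) ->
    (forall b, \sum_a s (a, b) = \sum_a s' (a, b)) -> s' x <= s x.
  case: x => a b before s0' ns row col; rewrite leNgt; apply/negP => slt.
  have [|b' sb' rb'] := later_support (g := pair a) rinj _ s0' before slt (row a).
    by move=> ? ? [].
  have [|a' sa' ra'] :=
      later_support (g := fun a => (a, b)) rinj _ s0' before slt (col b).
    by move=> ? ? [].
  exact: ns sb' sa' rb' ra'.
move=> t0 t0' nt nt' row col x.
have [k] := ubnP (r x); elim: k x => // k IH x rx.
have before y : (r y < r x)%N -> t y = t' y.
  by move=> ryx; apply: IH; apply: leq_trans ryx _.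
by apply/eqP; rewrite eq_le !key // => y /before.
Qed.

Lemma row_add_point (t : I * J -> R) a b s k :
  \sum_b' (t (k, b') + s * ((k, b') == (a, b))%:R) =
  \sum_b' t (k, b') + s * (k == a)%:R.
Proof.
rewrite big_split /=; congr (_ + _); rewrite -mulr_sumr; congr (_ * _).
rewrite (bigD1 b) //= xpair_eqE eqxx andbT big1 ?addr0 // => b' nb.
by rewrite xpair_eqE (negPf nb) andbF.
Qed.

Lemma col_add_point (t : I * J -> R) a b s k :
  \sum_a' (t (a', k) + s * ((a', k) == (a, b))%:R) =
  \sum_a' t (a', k) + s * (k == b)%:R.
Proof.
rewrite big_split /=; congr (_ + _); rewrite -mulr_sumr; congr (_ * _).
rewrite (bigD1 a) //= xpair_eqE eqxx big1 ?addr0 // => b' nb.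
by rewrite xpair_eqE (negPf nb).
Qed.

Lemma sum_sub_point (K : finType) (f : K -> R) s k0 :
  \sum_k (f k - s * (k == k0)%:R) = \sum_k f k - s.
Proof.
rewrite big_split /= sumrN; congr (_ - _).
by rewrite (bigD1 k0) //= eqxx mulr1 big1 ?addr0 // => k /negPf ->; rewrite mulr0.
Qed.

(* The smallest entry of the rectangle greedily receives all the mass that its
   row and its column allow; this exhausts one of the two. *)
Lemma noncrossing_transport_exists (x : I -> R) (y : J -> R) :
  (forall a, 0 <= x a) -> (forall b, 0 <= y b) -> \sum_a x a = \sum_b y b ->
  exists t : I * J -> R, [/\ forall z, 0 <= t z, noncrossing (fun z => t z != 0),
    forall a, \sum_b t (a, b) = x a & forall b, \sum_a t (a, b) = y b].
Proof.
(* Induction on the number of nonzero margins. *)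
have [N] := ubnP (#|[pred a | x a != 0]| + #|[pred b | y b != 0]|).
elim: N x y => // N IH x y sN x0 y0 xy.
case: (pickP [pred a | x a != 0]) => [a1 a1x|xz]; last first.
  have xz' a : x a = 0 by apply/eqP; move: (xz a) => /= /negbFE.
  have yz b : y b = 0.
    by apply: (psumr_eq0P (P := predT)) => //; rewrite -xy big1.
  exists (fun=> 0); split => //; first by move=> ? ? ? ?; rewrite eqxx.
  - by move=> a; rewrite xz' big1.
  - by move=> b; rewrite yz big1.
case: (pickP [pred b | y b != 0]) => [b1 b1y|yz]; last first.
  have yz' b : y b = 0 by apply/eqP; move: (yz b) => /= /negbFE.
  move/eqP: a1x; case; apply: (psumr_eq0P (P := predT)) => //.
  by rewrite xy big1.
have [[a b] /= /andP[xa yb] ab_min] :=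
  @arg_minnP _ (a1, b1) [pred z | (x z.1 != 0) && (y z.2 != 0)] r
    (introT andP (conj a1x b1y)).
pose s := Num.min (x a) (y b).
have sx : s <= x a by rewrite ge_min lexx.
have sy : s <= y b by rewrite ge_min lexx orbT.
have s0 : 0 <= s by rewrite le_min x0 y0.
pose x' k := x k - s * (k == a)%:R; pose y' k := y k - s * (k == b)%:R.
have x0' k : 0 <= x' k.
  by rewrite /x'; case: (eqVneq k a) => [->|_]; rewrite ?mulr1 ?mulr0 ?subr_ge0 ?subr0.
have y0' k : 0 <= y' k.
  by rewrite /y'; case: (eqVneq k b) => [->|_]; rewrite ?mulr1 ?mulr0 ?subr_ge0 ?subr0.
have sub_x k : x' k != 0 -> x k != 0.
  rewrite /x'; case: (eqVneq k a) => [->|_]; rewrite ?mulr0 ?subr0 //.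
have sub_y k : y' k != 0 -> y k != 0.
  rewrite /y'; case: (eqVneq k b) => [->|_]; rewrite ?mulr0 ?subr0 //.
have [||||t [t0 nt row col]] := IH x' y'.
- rewrite -ltnS; apply: leq_trans sN; rewrite ltnS.
  have [xy_le|/ltW yx_le] := leP (x a) (y b).
    apply: (@leq_add _.+1); last by apply: subset_leq_card; apply/fintype.subsetP=> k /sub_y.
    apply: proper_card; apply/properP; split; first by apply/fintype.subsetP=> k /sub_x.
    by exists a => //; rewrite !inE /x' eqxx mulr1 /s (min_idPl xy_le) subrr eqxx.
  rewrite -addnS; apply: leq_add.
    by apply: subset_leq_card; apply/fintype.subsetP=> k /sub_x.
  apply: proper_card; apply/properP; split; first by apply/fintype.subsetP=> k /sub_y.
  by exists b => //; rewrite !inE /y' eqxx mulr1 /s (min_idPr yx_le) subrr eqxx.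
- by [].
- by [].
- by rewrite !sum_sub_point xy.
pose t1 z := t z + s * (z == (a, b))%:R.
have t10 z : 0 <= t1 z by rewrite addr_ge0 ?mulr_ge0.
have row1 k : \sum_b t1 (k, b) = x k by rewrite row_add_point row subrK.
have col1 k : \sum_a t1 (a, k) = y k by rewrite col_add_point col subrK.
have suppx k l : t1 (k, l) != 0 -> x k != 0.
  apply: contraNN => /eqP xk; apply/eqP.
  apply: (psumr_eq0P (P := predT) (F := fun l => t1 (k, l))) => //.
  by rewrite row1.
have suppy k l : t1 (k, l) != 0 -> y l != 0.
  apply: contraNN => /eqP yl; apply/eqP.
  apply: (psumr_eq0P (P := predT) (F := fun k => t1 (k, l))) => //.
  by rewrite col1.
exists t1; split => // k l k' l' kl' k'l lt1 lt2.
(* A crossing with corner [(k, l)] makes the margins of row [k] and column [l] nonzero, so [(a, b)]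
   does not come after [(k, l)]. The two crossing cells come later, hence differ from [(a, b)] and
   already cross in [t]. *)
have := ab_min (k, l); rewrite /= (suppx _ _ kl') (suppy _ _ k'l) => /(_ isT) le_kl.
have back z : t1 z != 0 -> (r (k, l) < r z)%N -> t z != 0.
  rewrite /t1; case: (eqVneq z (a, b)) => [->|_]; last by rewrite mulr0 addr0.
  by rewrite ltnNge le_kl.
exact: nt (back _ kl' lt1) (back _ k'l lt2) lt1 lt2.
Qed.
End Transport.

(** * Faces and facets of a point configuration *)

Section Facets.
Import Order.TTheory GRing.Theory Num.Theory.
Local Open Scope ring_scope.
Variables (R : realType) (d : nat) (I : finType) (p : I -> 'rV[R]_d).

Let diffmx (S : {set I}) (x0 : I) : 'M[R]_(#|I|, d) :=
  \matrix_(k < #|I|) (if enum_val k \in S then p (enum_val k) - p x0 else 0).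

Let diffmx_sub (S : {set I}) x0 x : x \in S -> (p x - p x0 <= diffmx S x0)%MS.
Proof.
move=> xS; have <- : row (enum_rank x) (diffmx S x0) = p x - p x0.
  by rewrite rowK enum_rankK xS.
exact: row_sub.
Qed.

Let sub_diffmx k (S : {set I}) x0 (M : 'M[R]_(k, d)) :
  (forall x, x \in S -> (p x - p x0 <= M)%MS) -> (diffmx S x0 <= M)%MS.
Proof.
move=> h; apply/row_subP => j; rewrite rowK.
by case: ifP => [/h //|_]; exact: sub0mx.
Qed.

(** Independence of the base point: differences to one point of [S] are combinations of differences
    to any other. *)
Lemma affdimE (S : {set I}) x0 : x0 \in S -> affdim p S = (\rank (diffmx S x0))%:Z.
Proof.
move=> x0S; rewrite /affdim; case: pickP => [x1 x1S|/(_ x0)]; last by rewrite x0S.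
have sub u v : u \in S -> v \in S -> (diffmx S u <= diffmx S v)%MS.
  move=> uS vS; apply: sub_diffmx => x xS.
  have -> : p x - p u = (p x - p v) - (p u - p v) by rewrite opprB addrA subrK.
  by rewrite addmx_sub ?eqmx_opp ?diffmx_sub.
by congr (_%:Z); apply: eqmx_rank; apply/andP; split; exact: sub.
Qed.

Lemma dotp_mulmx (u c : 'rV[R]_d) : dotp u c = (u *m c^T) 0 0.
Proof. by rewrite mxE; apply: eq_bigr => j _; rewrite mxE. Qed.

Lemma dotpB (u v c : 'rV[R]_d) : dotp (u - v) c = dotp u c - dotp v c.
Proof. by rewrite !dotp_mulmx mulmxBl !mxE. Qed.

Lemma dotpD (u v c : 'rV[R]_d) : dotp (u + v) c = dotp u c + dotp v c.
Proof. by rewrite !dotp_mulmx mulmxDl !mxE. Qed.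

Lemma dotp_deltaN (u : 'rV[R]_d) j : dotp u (- delta_mx 0 j) = - u 0 j.
Proof.
rewrite /dotp (bigD1 j) //= big1 => [|k nk].
  by rewrite !mxE !eqxx addr0 mulrN1.
by rewrite !mxE eqxx (negPf nk) oppr0 mulr0.
Qed.

(** The points outside [F] are translates by [v] of points of [F], so [v] and the differences in [F]
    span those of [A]. The functional [c] kills the differences in [F] but not [v], so the rank
    grows by exactly one. *)
Lemma facet_of_translate (A F : {set I}) (c v : 'rV[R]_d) x0 y0 :
  (forall x, x \in A -> dotp (p x) c <= 0) ->
  F = finset.finset (fun x => (x \in A) && (dotp (p x) c == 0)) ->
  x0 \in F -> y0 \in A -> y0 \notin F ->
  (forall x, x \in A -> x \notin F -> exists2 x', x' \in F & p x - p x' = v) ->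
  is_facet p A F.
Proof.
move=> Ac defF x0F y0A y0F trans.
have FA x : x \in F -> x \in A by rewrite defF inE => /andP[].
have Fc x : x \in F -> dotp (p x) c = 0 by rewrite defF inE => /andP[_ /eqP].
split; first by exists c, 0.
have [y1 y1F y1v] := trans _ y0A y0F.
have vc : v *m c^T != 0.
  apply: contra y0F => /eqP v0; rewrite defF inE y0A /=.
  have : dotp v c = 0 by rewrite dotp_mulmx v0 mxE.
  by rewrite -y1v dotpB (Fc _ y1F) subr0 => ->.
have Fx0c : diffmx F x0 *m c^T = 0.
  apply/row_matrixP => k; rewrite row_mul rowK row0; case: ifP => kF; last by rewrite mul0mx.
  apply/rowP => j; rewrite ord1 -dotp_mulmx dotpB !Fc // subr0 mxE //.
rewrite (affdimE x0F) (affdimE (FA _ x0F)).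
suff -> : \rank (diffmx A x0) = (\rank (diffmx F x0) + 1)%N by rewrite PoszD addrK.
have -> : \rank (diffmx A x0) = \rank (diffmx F x0 + v)%MS.
  apply: eqmx_rank; apply/andP; split.
    apply: sub_diffmx => x xA; have [xF|xF] := boolP (x \in F).
      by apply: submx_trans (addsmxSl _ _); exact: diffmx_sub.
    have [x' x'F xx'] := trans x xA xF.
    have -> : p x - p x0 = (p x' - p x0) + v by rewrite -xx' [RHS]addrC addrA subrK.
    by rewrite addmx_sub_adds // diffmx_sub.
  rewrite addsmx_sub sub_diffmx => [|x xF]; last by rewrite diffmx_sub ?FA.
  have -> : v = (p y0 - p x0) - (p y1 - p x0) by rewrite -y1v opprB addrA subrK.
  by apply: addmx_sub; rewrite ?eqmx_opp; apply: diffmx_sub; rewrite ?y0A ?FA.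
rewrite mxrank_disjoint_sum ?rank_rV.
  by rewrite (_ : v != 0) //; apply: contraNneq vc => ->; rewrite mul0mx.
apply/eqP/rowV0P => w; rewrite sub_capmx => /andP[/submxP[u wu] /sub_rVP[a wa]].
have : w *m c^T = 0 by rewrite wu -mulmxA Fx0c mulmx0.
rewrite wa -scalemxAl => /eqP; rewrite scaler_eq0 (negPf vc) orbF => /eqP ->.
by rewrite scale0r.
Qed.

(** The bottom of the recursion, where the dimension drops from 0 to -1. The empty face is cut out
    by the zero functional and the bound 1. *)
Lemma facet_of_point x : is_facet p [set x]%SET finset.set0.
Proof.
split.
  exists 0, 1; split=> [y _|]; first by rewrite /dotp big1 // => j _; rewrite mxE mulr0.
  apply/setP => y; rewrite !inE /dotp big1 => [|j _]; last by rewrite mxE mulr0.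
  by rewrite (eq_sym 0) oner_eq0 andbF.
rewrite (@affdimE [set x]%SET x) ?set11 // (_ : diffmx _ _ = 0).
  by rewrite mxrank0 /affdim; case: pickP => // y; rewrite inE.
by apply/row_matrixP => k; rewrite rowK row0 inE; case: eqP => // ->; rewrite subrr.
Qed.

(** The supporting functional is at most [b] at [x'] and at [y'], and the two values sum to [b + b],
    so both equal [b]. *)
Lemma face_exchange (A F : {set I}) x y x' y' : is_face p A F ->
  p x + p y = p x' + p y' -> x' \in A -> y' \in A -> x \in F -> y \in F ->
  x' \in F.
Proof.
move=> [c [b [Ab ->]]] eqp xA' yA'; rewrite !inE xA'.
move=> /andP[_ /eqP xb] /andP[_ /eqP yb] /=.
have := Ab _ xA'; have := Ab _ yA'.
have : dotp (p x') c + dotp (p y') c = b + b by rewrite -dotpD -eqp dotpD xb yb.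
by move=> h h1 h2; apply/eqP; apply/eqP; rewrite eq_le h2 /=; lra.
Qed.
End Facets.

(** * Faces of the reverse lexicographic triangulation of the grid *)

Section Flag.
Import Order.TTheory GRing.Theory Num.Theory.
Local Open Scope ring_scope.
Variables (R : realType) (m n : nat) (r : 'I_m * 'I_n -> nat).
Let P := @Pmn R m n.

Lemma Pmn_exchange a b a' b' : P (a, b) + P (a', b') = P (a, b') + P (a', b).
Proof.
apply/rowP => j; rewrite !mxE /= [LHS]addrACA [RHS]addrACA.
by rewrite [(_ == rshift m b)%:R + _]addrC.
Qed.

(** Being a product of a set of rows and a set of columns, in the form that passes to faces by
    exchange. *)
Definition rectangular (A : {set 'I_m * 'I_n}) :=
  forall a b a' b', (a, b) \in A -> (a', b') \in A -> (a, b') \in A.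

(** The corner of a crossing in [aN |: G] lies in the rectangular set [A], so it does not precede
    [aN]. The crossing cells are larger than the corner, hence differ from [aN] and already cross in
    [G]. *)
Lemma revlex_max_noncrossing A G : revlex_max P r A G -> rectangular A ->
  G \subset A /\ noncrossing r (fun x => x \in G).
Proof.
elim=> [_|{}A F {}G aN aNA aN_min facF aNF _ IH rectA].
  by split=> // a b a' b'; rewrite inE.
have FA x : x \in F -> x \in A.
  by case: facF => -[c [b [_ ->]]] _; rewrite inE => /andP[].
have rectF : rectangular F.
  move=> a b a' b' abF ab'F.
  have [abA ab'A] := (FA _ abF, FA _ ab'F).
  exact: face_exchange facF.1 (Pmn_exchange a b a' b') (rectA _ _ _ _ abA ab'A)
    (rectA _ _ _ _ ab'A abA) abF ab'F.
have [GF ncG] := IH rectF.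
have GA : aN |: G \subset A.
  apply/fintype.subsetP => x; rewrite !inE => /orP[/eqP -> //|xG].
  by apply: FA; apply: (fintype.subsetP GF).
split=> // a b a' b' abG ab'G lt1 lt2.
have abA : (a, b) \in A by apply: rectA (fintype.subsetP GA _ abG) (fintype.subsetP GA _ ab'G).
have notN x : x \in aN |: G -> (r (a, b) < r x)%N -> x \in G.
  by rewrite !inE => /orP[/eqP ->|//]; rewrite ltnNge aN_min.
exact: ncG (notN _ abG lt1) (notN _ ab'G lt2) lt1 lt2.
Qed.

Lemma Pmn_lshift x a : P x 0 (lshift n a) = (x.1 == a)%:R.
Proof. by rewrite mxE (inj_eq (@lshift_inj _ _)) eq_lrshift addr0 eq_sym. Qed.

Lemma Pmn_rshift x b : P x 0 (rshift m b) = (x.2 == b)%:R.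
Proof. by rewrite mxE (inj_eq (@rshift_inj _ _)) eq_rlshift add0r eq_sym. Qed.

(** The facet where coordinate [a] takes its minimum 0. Each cell of row [a] is the cell of row [a']
    in the same column, translated by a fixed vector. *)
Lemma delete_row_facet (S : {set 'I_m}) (T : {set 'I_n}) a a' b :
  a \in S -> a' \in S -> a' != a -> b \in T ->
  is_facet P (finset.setX S T) (finset.setX (S :\ a)%SET T).
Proof.
move=> aS a'S na bT.
have dotpE x : dotp (P x) (- delta_mx 0 (lshift n a)) = - (x.1 == a)%:R.
  by rewrite dotp_deltaN Pmn_lshift.
apply: (@facet_of_translate _ _ _ _ _ _ (- delta_mx 0 (lshift n a))
  (P (a, b) - P (a', b)) (a', b) (a, b)).
- by move=> x _; rewrite dotpE oppr_le0.
- apply/setP => -[k l]; rewrite !inE dotpE oppr_eq0 /=.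
  by case: (k == a); rewrite ?oner_eq0 ?eqxx ?andbF ?andbT //=.
- by rewrite !inE na a'S bT.
- by rewrite !inE aS bT.
- by rewrite !inE eqxx.
move=> [k l]; rewrite !inE /= => /andP[kS lT]; rewrite kS lT !andbT negbK => /eqP ->.
exists (a', l); first by rewrite !inE na a'S.
by apply/eqP; rewrite subr_eq addrAC eq_sym subr_eq Pmn_exchange.
Qed.

Lemma delete_col_facet (S : {set 'I_m}) (T : {set 'I_n}) a b b' :
  a \in S -> b \in T -> b' \in T -> b' != b ->
  is_facet P (finset.setX S T) (finset.setX S (T :\ b)%SET).
Proof.
move=> aS bT b'T nb.
have dotpE x : dotp (P x) (- delta_mx 0 (rshift m b)) = - (x.2 == b)%:R.
  by rewrite dotp_deltaN Pmn_rshift.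
apply: (@facet_of_translate _ _ _ _ _ _ (- delta_mx 0 (rshift m b))
  (P (a, b) - P (a, b')) (a, b') (a, b)).
- by move=> x _; rewrite dotpE oppr_le0.
- apply/setP => -[k l]; rewrite !inE dotpE oppr_eq0 /=.
  by case: (l == b); rewrite ?oner_eq0 ?eqxx ?andbF ?andbT //=.
- by rewrite !inE nb aS b'T.
- by rewrite !inE aS bT.
- by rewrite !inE eqxx andbF.
move=> [k l]; rewrite !inE /= => /andP[kS lT]; rewrite kS lT !andbT negbK => /eqP ->.
exists (k, b'); first by rewrite !inE nb b'T kS.
by apply/eqP; rewrite subr_eq addrAC eq_sym subr_eq Pmn_exchange addrC.
Qed.

(** Induction on the size of the subgrid. Its smallest cell [(a, b)] is the apex, and the rest
    [sigma'] of [sigma] misses row [a] or column [b], so it lies in the facet obtained by deleting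
    that line. *)
Lemma noncrossing_in_revlex_max (S : {set 'I_m}) (T : {set 'I_n})
    (sigma : {set 'I_m * 'I_n}) a0 b0 :
  injective r -> a0 \in S -> b0 \in T -> sigma \subset finset.setX S T ->
  noncrossing r (fun x => x \in sigma) ->
  exists2 G, revlex_max P r (finset.setX S T) G & sigma \subset G.
Proof.
move=> rinj; have [N] := ubnP (#|S| + #|T|).
elim: N S T sigma a0 b0 => // N IH S T sigma a0 b0 sN a0S b0T sST nc.
have ab0 : (a0, b0) \in finset.setX S T by rewrite finset.in_setX a0S.
have [[a b] /=] := @arg_minnP _ (a0, b0) (fun x => x \in finset.setX S T) r ab0.
rewrite finset.in_setX => /andP[/= aS bT] ab_min.
have abST : (a, b) \in finset.setX S T by rewrite finset.in_setX aS.
have strict x : x \in finset.setX S T -> x != (a, b) -> (r (a, b) < r x)%N.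
  by move=> xST; rewrite ltn_neqAle ab_min // andbT (inj_eq rinj) eq_sym.
pose sigma' := (sigma :\ (a, b))%SET.
have sub' x : x \in sigma' -> x \in sigma by rewrite !inE => /andP[].
have nc' : noncrossing r (fun x => x \in sigma').
  by move=> k l k' l' /sub' kl' /sub' k'l; exact: nc kl' k'l.
have cone F : is_facet P (finset.setX S T) F -> (a, b) \notin F ->
    (exists2 G, revlex_max P r F G & sigma' \subset G) ->
    exists2 G, revlex_max P r (finset.setX S T) G & sigma \subset G.
  move=> facF abF [G FG sG]; exists ((a, b) |: G)%SET.
    by apply: RL_cone FG => // x; exact: ab_min.
  by rewrite -finset.subDset.
have row : {in sigma', forall x, x.1 != a} -> (exists2 a', a' \in S & a' != a) ->
    exists2 G, revlex_max P r (finset.setX S T) G & sigma \subset G.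
  move=> off [a' a'S na]; apply: (cone _ (delete_row_facet aS a'S na bT)).
    by rewrite !inE eqxx.
  apply: (IH _ _ _ a' b) => //; last 1 first.
  - apply/fintype.subsetP => -[k l] kl; rewrite !inE (off _ kl) /=.
    by have := fintype.subsetP sST _ (sub' _ kl); rewrite finset.in_setX.
  - by rewrite -ltnS; apply: leq_trans sN; rewrite ltnS [in ltnRHS](cardsD1 a) aS.
  - by rewrite !inE na.
have col : {in sigma', forall x, x.2 != b} -> (exists2 b', b' \in T & b' != b) ->
    exists2 G, revlex_max P r (finset.setX S T) G & sigma \subset G.
  move=> off [b' b'T nb]; apply: (cone _ (delete_col_facet aS bT b'T nb)).
    by rewrite !inE eqxx andbF.
  apply: (IH _ _ _ a b') => //; last 1 first.
  - apply/fintype.subsetP => -[k l] kl; rewrite !inE (off _ kl) /=.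
    by have := fintype.subsetP sST _ (sub' _ kl); rewrite finset.in_setX.
  - by rewrite -ltnS; apply: leq_trans sN; rewrite ltnS [in ltnRHS](cardsD1 b) bT addnCA.
  - by rewrite !inE nb.
have [/existsP[a' /andP[a'S na]]|/existsPn Sa] := boolP [exists a', (a' \in S) && (a' != a)];
have [/existsP[b' /andP[b'T nb]]|/existsPn Tb] := boolP [exists b', (b' \in T) && (b' != b)].
(* Cells of [sigma'] in row [a] and in column [b] would cross at the corner [(a, b)], so one of the
   two lines is free. *)
- have [/forallP off|/forallPn[[k l]]] := boolP [forall x, (x \in sigma') ==> (x.1 != a)].
    by apply: row; [move=> x; exact/implyP|exists a'].
  rewrite negb_imply negbK /= => /andP[kl /eqP ka].
  apply: col; last by exists b'.
  move=> [k' l'] kl' /=; apply/eqP => lb; subst k l'.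
  have := fintype.subsetP sST _ (sub' _ kl); have := fintype.subsetP sST _ (sub' _ kl').
  move=> /strict h' /strict h; apply: nc (sub' _ kl) (sub' _ kl') (h _) (h' _).
    by move: kl; rewrite !inE => /andP[].
  by move: kl'; rewrite !inE => /andP[].
(* With a single column left, row [a] consists of [(a, b)] only, which [sigma'] omits. *)
- apply: row; last by exists a'.
  move=> [k l] kl /=; apply/eqP => ka; subst k.
  have := fintype.subsetP sST _ (sub' _ kl); rewrite finset.in_setX /= => /andP[_ lT].
  have := Tb l; rewrite lT negbK => /eqP lb.
  by move: kl; rewrite lb !inE eqxx.
- apply: col; last by exists b'.
  move=> [k l] kl /=; apply/eqP => lb; subst l.
  have := fintype.subsetP sST _ (sub' _ kl); rewrite finset.in_setX /= => /andP[kS _].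
  have := Sa k; rewrite kS negbK => /eqP ka.
  by move: kl; rewrite ka !inE eqxx.
(* A single cell remains, and it is a cone over the empty facet. *)
have ST1 : finset.setX S T = [set (a, b)]%SET.
  apply/setP => -[k l]; rewrite !inE /= xpair_eqE; apply/andP/andP.
    by move=> [kS lT]; move: (Sa k) (Tb l); rewrite kS lT !negbK.
  by move=> [/eqP -> /eqP ->].
apply: (cone finset.set0); rewrite ?inE //; first by rewrite ST1; exact: facet_of_point.
exists finset.set0; first exact: RL_nil.
by rewrite finset.subDset finset.setU0 -ST1.
Qed.

Lemma revlex_face_avoidingP (V sigma : {set 'I_m * 'I_n}) :
  injective r -> (0 < m)%N -> (0 < n)%N ->
  revlex_face_avoiding P r V sigma <->
  noncrossing r (fun x => x \in sigma) /\ (forall x, x \in sigma -> x \notin V).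
Proof.
move=> rinj m0 n0; split=> [[G [TG [sG sV]]]|[nc sV]].
  split=> // a b a' b' /(fintype.subsetP sG) ? /(fintype.subsetP sG) ?.
  have [_] := revlex_max_noncrossing TG (fun _ _ _ _ _ _ => finset.in_setT _).
  by apply; eassumption.
have TT : finset.setX [set: 'I_m]%SET [set: 'I_n]%SET = [set: 'I_m * 'I_n]%SET.
  by apply/setP => x; rewrite !inE.
have [||//|G TG sG] := @noncrossing_in_revlex_max [set: 'I_m]%SET [set: 'I_n]%SET sigma
  (Ordinal m0) (Ordinal n0) rinj _ _ _ nc; rewrite ?inE // ?TT ?finset.subsetT //.
by exists G; rewrite -TT.
Qed.
End Flag.

(** * Coordinates on the realization: differences of row and column margins *)

Section DifferenceCoordinates.
Import Order.TTheory GRing.Theory Num.Theory.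
Local Open Scope classical_set_scope.
Local Open Scope ring_scope.
Variables (R : realType) (m n i N : nat) (r : 'I_m * 'I_n -> nat).

Implicit Type t : 'rV[R]_#|{: 'I_m * 'I_n}|.

Definition entry t (x : 'I_m * 'I_n) : R := t 0 (enum_rank x).

(* Row [l] and column [l] share the coordinate [l < i]; the remaining rows keep
   their index and the remaining columns are shifted behind all rows. *)
Definition col_coord (b : nat) : nat := if (b < i)%N then b else (b + (m - i))%N.

Lemma col_coord_inj : injective col_coord.
Proof. by move=> b b'; rewrite /col_coord; case: ifP; case: ifP; lia. Qed.

(** Masses are indexed by the coordinates of the target space and vanish where no row, respectively
    no column, is attached. As weighted sums of entries they are visibly continuous. *)
Definition row_mass t (l : nat) : R := \sum_x entry t x * (x.1 == l :> nat)%:R.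
Definition col_mass t (l : nat) : R := \sum_x entry t x * (col_coord x.2 == l)%:R.

Lemma sum_pair (F : 'I_m * 'I_n -> R) : \sum_x F x = \sum_a \sum_b F (a, b).
Proof. by rewrite pair_bigA; apply: eq_bigr => -[]. Qed.

Lemma row_massE t (a : 'I_m) : row_mass t a = \sum_b entry t (a, b).
Proof.
rewrite /row_mass sum_pair /=.
rewrite (bigD1 a) //= [X in _ + X]big1 ?addr0 => [|a' na].
  by apply: eq_bigr => b _; rewrite eqxx mulr1.
by apply: big1 => b _; rewrite (negPf (na : (a' != a :> nat))) mulr0.
Qed.

Lemma col_massE t (b : 'I_n) : col_mass t (col_coord b) = \sum_a entry t (a, b).
Proof.
rewrite /col_mass sum_pair /=.
apply: eq_bigr => a _; rewrite (bigD1 b) //= big1 ?addr0 => [|b' nb].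
  by rewrite eqxx mulr1.
by rewrite (inj_eq col_coord_inj) (negPf (nb : (b' != b :> nat))) mulr0.
Qed.

Definition difference_coord t : 'rV[R]_N := \row_l (row_mass t l - col_mass t l).

(** Coordinates in [[i, m)] come from rows only and those from [m] on from columns only, whence the
    signs. The norm is 2 because row and column masses each total 1. *)
Definition difference_sphere : set 'rV[R]_N :=
  [set w : 'rV[R]_N | [/\ \sum_l w 0 l = 0, \sum_l `|w 0 l| = 2,
     forall l : 'I_N, (i <= l < m)%N -> 0 <= w 0 l & forall l : 'I_N, (m <= l)%N -> w 0 l <= 0]].

Lemma sum_indicator (l0 : nat) : (l0 < N)%N -> \sum_(l < N) ((l0 == l)%:R : R) = 1.
Proof.
move=> lt; rewrite (bigD1 (Ordinal lt)) //= eqxx big1 ?addr0 // => l nl.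
by case: (eqVneq l0 l) nl => // e; rewrite -val_eqE /= -e eqxx.
Qed.

Lemma row_mass_out t l : (m <= l)%N -> row_mass t l = 0.
Proof.
by move=> ml; apply: big1 => x _; case: eqP => [xl|]; rewrite ?mulr0 //; have := ltn_ord x.1; lia.
Qed.

Lemma col_mass_out t l : (i <= l < m)%N -> col_mass t l = 0.
Proof.
move=> ml; apply: big1 => x _; rewrite /col_coord; case: ifP => ?;
 by case: eqP => [xl|]; rewrite ?mulr0 //; lia.
Qed.

Lemma sum_injective_image (K : finType) (g : K -> 'I_N) (F : 'I_N -> R) :
  injective g -> (forall l, F l != 0 -> exists k, g k = l) ->
  \sum_k F (g k) = \sum_l F l.
Proof.
move=> ginj supp.
rewrite -(big_imset F (h := g) (A := predT)) /=; last by move=> ? ? _ _ /ginj.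
rewrite big_mkcond; apply: eq_bigr => l _; case: ifPn => // lg.
apply/eqP; rewrite eq_sym; apply: contraR lg => /supp[k <-].
by apply/imsetP; exists k.
Qed.

Hypotheses (m0 : (0 < m)%N) (im : (i <= m)%N) (mn : (m <= n)%N).
Hypotheses (rinj : injective r)
  (rcone : forall x y, is_cone_var i x -> ~~ is_cone_var i y -> (r x < r y)%N).
Hypothesis defN : (m + n = N + i)%N.

Lemma col_coord_bound (b : 'I_n) : (col_coord b < N)%N.
Proof. by have := ltn_ord b; rewrite /col_coord; case: ifP; lia. Qed.

Lemma sum_row_mass t : \sum_(l < N) row_mass t l = \sum_x entry t x.
Proof.
rewrite exchange_big; apply: eq_bigr => x _; rewrite -mulr_sumr sum_indicator ?mulr1 //.
by have := ltn_ord x.1; lia.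
Qed.

Lemma sum_col_mass t : \sum_(l < N) col_mass t l = \sum_x entry t x.
Proof.
rewrite exchange_big; apply: eq_bigr => x _; rewrite -mulr_sumr sum_indicator ?mulr1 //.
exact: col_coord_bound.
Qed.

(** Any face carrying [t] contains the support of [t], and subsets of faces are faces, so the
    support itself can serve as the face. *)
Lemma revlex_minus_coneP t : revlex_minus_cone i r t <->
  [/\ forall x, 0 <= entry t x, \sum_x entry t x = 1,
      noncrossing r (fun x => entry t x != 0) &
      forall x, is_cone_var i x -> entry t x = 0].
Proof.
have n0 : (0 < n)%N := leq_trans m0 mn.
have sumE : \sum_x entry t x = \sum_k t 0 k.
  rewrite [RHS](reindex (@enum_rank _)) //=.
  by exists enum_val => x _; rewrite ?enum_rankK ?enum_valK.
split=> [[sigma [/(revlex_face_avoidingP _ _ _ rinj m0 n0)[nc sV] [t0 [ts t1]]]]|].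
  have supp x : entry t x != 0 -> x \in sigma.
    by apply: contraNT => xs; apply/eqP/ts; rewrite enum_rankK.
  split=> //; [by move=> x; exact: t0|by rewrite sumE| |].
    by move=> a b a' b' /supp ? /supp ?; exact: nc.
  move=> x xc; apply/eqP; apply: contraT => /supp/sV.
  by rewrite inE xc.
move=> [t0 t1 nc tc]; exists (finset.finset (fun x => entry t x != 0)); split.
  apply/(revlex_face_avoidingP _ _ _ rinj m0 n0); split.
    by move=> a b a' b'; rewrite !inE; exact: nc.
  by move=> x; rewrite !inE; apply: contraNN => /tc ->.
split; first by move=> k; rewrite -[k]enum_valK; exact: t0.
split; last by rewrite -sumE.
by move=> k; rewrite inE negbK => /eqP; rewrite /entry enum_valK.
Qed.

(** For [l < i] the cell [(l, l)] precedes every cell of the support, so support in both row [l] and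
    column [l] would cross at that corner. Every other coordinate belongs to a row only or to a
    column only. *)
Lemma row_col_mass_disjoint t l : revlex_minus_cone i r t ->
  row_mass t l = 0 \/ col_mass t l = 0.
Proof.
move=> /revlex_minus_coneP[t0 t1 nc tc].
have [li|il] := ltnP l i; last first.
  have [ml|lm] := leqP m l; first by left; exact: row_mass_out.
  by right; apply: col_mass_out; rewrite il.
have lm : (l < m)%N by lia.
have ln : (l < n)%N by lia.
have cl : col_coord (Ordinal ln) = l by rewrite /col_coord /= li.
have := row_massE t (Ordinal lm); have := col_massE t (Ordinal ln).
rewrite cl /= => -> ->.
set a : 'I_m := Ordinal lm; set b : 'I_n := Ordinal ln.
have abc : is_cone_var i (a, b) by rewrite /is_cone_var /= eqxx.
have cone_lt x : entry t x != 0 -> (r (a, b) < r x)%N.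
  by move=> tx; apply: rcone => //; apply: contraNN tx => /tc ->.
have [/forallP h|/forallPn[b' tb']] := boolP [forall b', entry t (a, b') == 0].
  by left; apply: big1 => b' _; apply/eqP.
right; apply: big1 => a' _; apply/eqP; apply: contraT => ta'.
by case: (nc a b a' b' tb' ta' (cone_lt _ tb') (cone_lt _ ta')).
Qed.

Lemma row_mass_ge0 t l : revlex_minus_cone i r t -> 0 <= row_mass t l.
Proof. by move=> /revlex_minus_coneP[t0 _ _ _]; apply: sumr_ge0 => x _; rewrite mulr_ge0. Qed.

Lemma col_mass_ge0 t l : revlex_minus_cone i r t -> 0 <= col_mass t l.
Proof. by move=> /revlex_minus_coneP[t0 _ _ _]; apply: sumr_ge0 => x _; rewrite mulr_ge0. Qed.

(* [row_mass t l] and [col_mass t l] are the positive and negative parts of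
   coordinate [l]. *)
Lemma difference_coord_sphere t :
  revlex_minus_cone i r t -> difference_sphere (difference_coord t).
Proof.
move=> tK; have [t0 t1 nc tc] := (revlex_minus_coneP t).1 tK.
split.
- under eq_bigr do rewrite mxE.
  by rewrite sumrB sum_row_mass sum_col_mass subrr.
- have -> : \sum_l `|difference_coord t 0 l| = \sum_(l < N) (row_mass t l + col_mass t l).
    apply: eq_bigr => l _; rewrite mxE.
    have rl := row_mass_ge0 l tK; have cl := col_mass_ge0 l tK.
    by case: (row_col_mass_disjoint l tK) => ->;
      rewrite ?sub0r ?subr0 ?add0r ?addr0 ?normrN ger0_norm.
  by rewrite big_split /= sum_row_mass sum_col_mass t1.
- by move=> l il; rewrite mxE col_mass_out // subr0 row_mass_ge0.
- by move=> l il; rewrite mxE row_mass_out // sub0r oppr_le0 col_mass_ge0.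
Qed.

(** Nonnegative masses of which one vanishes are recovered from their difference; the margins then
    determine the matrix. *)
Lemma difference_coord_inj t t' : revlex_minus_cone i r t -> revlex_minus_cone i r t' ->
  difference_coord t = difference_coord t' -> t = t'.
Proof.
move=> tK tK' /rowP eqd.
have [t0 t1 nc tc] := (revlex_minus_coneP t).1 tK.
have [t0' t1' nc' tc'] := (revlex_minus_coneP t').1 tK'.
have masses (l : 'I_N) : row_mass t l = row_mass t' l /\ col_mass t l = col_mass t' l.
  have := eqd l; rewrite !mxE.
  have := row_mass_ge0 l tK; have := row_mass_ge0 l tK'.
  have := col_mass_ge0 l tK; have := col_mass_ge0 l tK'.
  by case: (row_col_mass_disjoint l tK) => ->;
    case: (row_col_mass_disjoint l tK') => ->; lra.
have eqt : entry t =1 entry t'.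
  apply: (noncrossing_transport_unique (r := r)) => //.
    move=> a; rewrite -!row_massE.
    have aN : (a < N)%N by have := ltn_ord a; lia.
    by have [] := masses (Ordinal aN).
  move=> b; rewrite -!col_massE.
  by have [_] := masses (Ordinal (col_coord_bound b)).
by apply/rowP => k; have := eqt (enum_val k); rewrite /entry enum_valK.
Qed.

Lemma col_coord_surj l : (l < N)%N -> ~~ (i <= l < m)%N ->
  exists b : 'I_n, col_coord b = l.
Proof.
move=> lN lim; have [li|il] := ltnP l i.
  have ln : (l < n)%N by lia.
  by exists (Ordinal ln); rewrite /col_coord /= li.
have ln : (l - (m - i) < n)%N by lia.
by exists (Ordinal ln); rewrite /col_coord /=; case: ifP; lia.
Qed.

(** The positive parts of [w] serve as row margins and the negative parts as column margins; their
    totals have difference 0 and sum 2, so both are 1. *)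
Lemma difference_coord_surj w : difference_sphere w ->
  exists2 t, revlex_minus_cone i r t & difference_coord t = w.
Proof.
move=> [w0 w2 wx wy].
(* [f] extends [w] by 0, so that row numbers and [col_coord] values can be used as indices. *)
pose f (l : nat) : R := if insub l is Some l' then w 0 l' else 0.
have fE (l : 'I_N) : f l = w 0 l by rewrite /f valK.
pose x (a : 'I_m) := Num.max (f a) 0.
pose y (b : 'I_n) := Num.max (- f (col_coord b)) 0.
have posneg l : Num.max (f l) 0 - Num.max (- f l) 0 = f l /\
    Num.max (f l) 0 + Num.max (- f l) 0 = `|f l|.
  case/orP: (le_total 0 (f l)) => fl.
    by rewrite (max_idPl fl) (max_idPr _) ?oppr_le0 // subr0 addr0 ger0_norm.
  by rewrite (max_idPr fl) (max_idPl _) ?oppr_ge0 // sub0r add0r opprK ler0_norm.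
have max0l (l : 'I_N) : (m <= l)%N -> Num.max (f l) 0 = 0.
  by move=> ml; apply/max_idPr; rewrite fE wy.
have max0r (l : 'I_N) : (i <= l < m)%N -> Num.max (- f l) 0 = 0.
  by move=> ml; apply/max_idPr; rewrite fE oppr_le0 wx.
have mN : (m <= N)%N by lia.
have sx : \sum_a x a = \sum_(l < N) Num.max (f l) 0.
  apply: (@sum_injective_image _ (widen_ord mN) (fun l : 'I_N => Num.max (f l) 0)).
    by move=> a a' /(congr1 val) /= /val_inj.
  move=> l fl; have lm : (l < m)%N.
    by rewrite ltnNge; apply: contraNN fl => /max0l ->.
  by exists (Ordinal lm); exact: val_inj.
have sy : \sum_b y b = \sum_(l < N) Num.max (- f l) 0.
  apply: (@sum_injective_image _ (fun b => Ordinal (col_coord_bound b))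
    (fun l : 'I_N => Num.max (- f l) 0)).
    by move=> b b' /(congr1 val) /= /col_coord_inj/val_inj.
  move=> l fl; have [|b bl] := @col_coord_surj l (ltn_ord l).
    by apply: contraNN fl => /max0r ->.
  by exists b; exact: val_inj.
have sums : \sum_a x a = 1 /\ \sum_b y b = 1.
  have e0 : \sum_a x a - \sum_b y b = 0.
    by rewrite sx sy -sumrB -[RHS]w0; apply: eq_bigr => l _; rewrite (posneg l).1 fE.
  have e2 : \sum_a x a + \sum_b y b = 2.
    by rewrite sx sy -big_split -[RHS]w2; apply: eq_bigr => l _; rewrite /= (posneg l).2 fE.
  by lra.
have [|||s [s0 nc row col]] := @noncrossing_transport_exists _ _ _ r x y.
- by move=> a; rewrite le_max lexx orbT.
- by move=> a; rewrite le_max lexx orbT.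
- by rewrite sums.1 sums.2.
pose t : 'rV[R]_#|{: 'I_m * 'I_n}| := \row_k s (enum_val k).
have tE z : entry t z = s z by rewrite /entry mxE enum_rankK.
have rowE (a : 'I_m) : row_mass t a = x a.
  by rewrite row_massE -row; apply: eq_bigr => b _.
have colE (b : 'I_n) : col_mass t (col_coord b) = y b.
  by rewrite col_massE -col; apply: eq_bigr => a _.
exists t.
  apply/revlex_minus_coneP; split.
  - by move=> z; rewrite tE.
  - by rewrite sum_pair -sums.1; apply: eq_bigr => a _; rewrite -row; apply: eq_bigr => b _.
  - by move=> a b a' b'; rewrite !tE; exact: nc.
  move=> [a b] /andP[/= /eqP ab ai]; rewrite tE.
  (* At a removed cell, row and column share one coordinate, so [x a] and [y b] are the positive and
     negative parts of one number. One of them is 0, and both bound the entry. *)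
  have yb : y b = Num.max (- f a) 0 by rewrite /y /col_coord -ab ai.
  have xle : s (a, b) <= x a by rewrite -row (bigD1 b) //= lerDl sumr_ge0.
  have yle : s (a, b) <= y b by rewrite -col (bigD1 a) //= lerDl sumr_ge0.
  have := s0 (a, b); move: xle yle; rewrite yb /x.
  case/orP: (le_total 0 (f a)) => fa.
    rewrite (@max_idPr _ _ (- f a) 0 _) ?oppr_le0 //; lra.
  by rewrite (@max_idPr _ _ (f a) 0 fa); lra.
apply/rowP => l; rewrite mxE -fE -(posneg l).1; congr (_ - _).
  have [ml|lm] := leqP m l; first by rewrite row_mass_out ?max0l.
  exact: (rowE (Ordinal lm)).
have [lim|lim] := boolP (i <= l < m)%N; first by rewrite col_mass_out ?max0r.
by have [b bl] := @col_coord_surj l (ltn_ord l) lim; rewrite -bl colE /y bl.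
Qed.
End DifferenceCoordinates.

(** * Continuity, and homeomorphisms from compact sets *)

Section Topology.
Import Order.TTheory GRing.Theory Num.Theory.
Local Open Scope classical_set_scope.
Local Open Scope ring_scope.

(** The preimage of a closed [C] under the inverse is, within [B], the image of [A] intersected with
    [C], which is compact and hence closed. Off [B] the inverse takes the default [point]. *)
Lemma compact_bijection_homeomorphic (U : ptopologicalType) (V : topologicalType)
    (A : set U) (B : set V) (f : U -> V) :
  hausdorff_space V -> compact A -> {within A, continuous f} ->
  (forall x, A x -> B (f x)) ->
  (forall x y, A x -> A y -> f x = f y -> x = y) ->
  (forall y, B y -> exists2 x, A x & f x = y) ->
  homeomorphic A B.
Proof.
move=> hV cA cf fB finj fsurj.
pose g y := xget point [set x | A x /\ f x = y].
have gP y : B y -> A (g y) /\ f (g y) = y.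
  by move=> /fsurj[x Ax fx]; rewrite /g; case: xgetP => [z _ //|/(_ x)]; case.
exists f, g; split=> //; split; last first.
  split=> //; split=> [y /gP[] //|]; split=> [x Ax|y /gP[]//].
  by have [? ?] := gP _ (fB _ Ax); exact: finj.
apply/continuous_closedP => C clC; apply/closed_subspaceP.
have cAC : compact (A `&` C) by exact: compact_closedI.
exists (f @` (A `&` C)).
  apply: compact_closed => //; apply: continuous_compact => //.
  by apply: continuous_subspaceW cf => x [].
apply/seteqP; split=> y /= [yC By]; split=> //.
  have [Ag fg] := gP _ By; case: yC => x [Ax Cx] fx.
  suff e : x = g y by rewrite e in Cx.
  by apply: finj => //; rewrite fg.
by have [Ag fg] := gP _ By; exists (g y).
Qed.

Variable R : realType.

(** A neighbourhood of a row vector contains a product of neighbourhoods of its finitely many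
    entries. *)
Lemma continuous_at_rV (T : topologicalType) k (f : T -> 'rV[R]_k) x :
  (forall j, {for x, continuous (fun y => f y 0 j)}) -> {for x, continuous f}.
Proof.
move=> cf A [P fP PA]; rewrite /= nbhs_simpl /=.
have : \forall y \near x, forall j, P 0 j (f y 0 j).
  by apply: filter_forall => j; apply: (cf j); exact: fP.
by apply: filterS => y h; apply: PA => a j; rewrite ord1; exact: h.
Qed.

Lemma continuous_sum (T : topologicalType) (I : finType) (F : I -> T -> R) :
  (forall j, continuous (F j)) -> continuous (fun y => \sum_j F j y).
Proof. by move=> cF; apply: continuous_big => // ; exact: add_continuous. Qed.

Lemma continuous_bigmin (T : topologicalType) (I : finType) (P : pred I) (F : I -> T -> R) G :
  continuous G -> (forall j, continuous (F j)) ->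
  continuous (fun y => \big[Num.min/G y]_(j | P j) F j y).
Proof.
move=> cG cF; elim: (index_enum I) => [|j s IH].
  by under eq_fun do rewrite big_nil.
under eq_fun do rewrite big_cons.
by case: (P j) => //; apply: min_fun_continuous.
Qed.

Lemma continuous_scaleV (T : topologicalType) k (f : T -> R) (g : T -> 'rV[R]_k) x :
  f x != 0 -> {for x, continuous f} -> {for x, continuous g} ->
  {for x, continuous (fun y => (f y)^-1 *: g y)}.
Proof. by move=> fx cf cg; apply: cvgZ => //; exact: cvgV. Qed.

Lemma continuous_mulrC (T : topologicalType) (f : T -> R) c :
  continuous f -> continuous (fun y => f y * c).
Proof. by move=> cf y; apply: cvgM; [exact: cf|exact: cvg_cst]. Qed.

Lemma continuous_addr (T : topologicalType) (f g : T -> R) :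
  continuous f -> continuous g -> continuous (fun y => f y + g y).
Proof. by move=> cf cg y; apply: cvgD; [exact: cf|exact: cg]. Qed.

Lemma continuous_subr (T : topologicalType) (f g : T -> R) :
  continuous f -> continuous g -> continuous (fun y => f y - g y).
Proof. by move=> cf cg y; apply: cvgB; [exact: cf|exact: cg]. Qed.

(** * Radial projection between two sections of a cone *)

Section RadialProjection.
Variables (N k q : nat) (X : set 'rV[R]_q) (L : 'rV[R]_q -> 'rV[R]_N).
Variables (C : set 'rV[R]_N) (B : set 'rV[R]_k).
Variables (h : 'rV[R]_N -> 'rV[R]_k) (gauge : 'rV[R]_N -> R).
Hypotheses (cX : compact X) (cL : continuous L)
  (LC : forall t, X t -> C (L t) /\ \sum_l `|L t 0 l| = 2)
  (Linj : forall t t', X t -> X t' -> L t = L t' -> t = t')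
  (Lsurj : forall w, C w -> \sum_l `|w 0 l| = 2 -> exists2 t, X t & L t = w).
Hypotheses (ch : continuous h) (cgauge : continuous gauge)
  (CZ : forall c w, 0 < c -> C w -> C (c *: w))
  (hZ : forall c w, 0 < c -> h (c *: w) = c *: h w)
  (gaugeZ : forall c w, 0 < c -> gauge (c *: w) = c * gauge w).
Hypotheses (gauge_gt0 : forall w, C w -> w != 0 -> 0 < gauge w)
  (hB : forall w, C w -> gauge w = 1 -> B (h w))
  (hinj : forall w w', C w -> C w' -> gauge w = 1 -> gauge w' = 1 -> h w = h w' -> w = w')
  (hsurj : forall v, B v -> exists w, [/\ C w, gauge w = 1 & h w = v]).

(** [L] identifies [X] with the section of the cone [C] by the sum of absolute values, and [h]
    identifies the section [gauge = 1] with [B]. Each ray meets both sections once, so rescaling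
    along rays joins the two identifications. *)
Lemma radial_homeomorphic : homeomorphic X B.
Proof.
have nz (w : 'rV[R]_N) : \sum_l `|w 0 l| = 2 -> w != 0.
  move=> w2; apply/eqP => w0; move: w2; rewrite w0 big1 => [|l _]; first by lra.
  by rewrite mxE normr0.
have norm1Z c (w : 'rV[R]_N) : 0 < c -> \sum_l `|(c *: w) 0 l| = c * \sum_l `|w 0 l|.
  move=> c0; rewrite mulr_sumr; apply: eq_bigr => l _.
  by rewrite mxE normrM gtr0_norm.
have gL t : X t -> 0 < gauge (L t).
  by move=> /LC[CL L2]; apply: gauge_gt0 => //; exact: nz.
have unit t : X t -> C ((gauge (L t))^-1 *: L t) /\ gauge ((gauge (L t))^-1 *: L t) = 1.
  move=> Xt; have g0 := gL _ Xt.
  split; first by apply: CZ; rewrite ?invr_gt0 //; have [] := LC Xt.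
  by rewrite gaugeZ ?invr_gt0 // mulVf // gt_eqF.
apply: (@compact_bijection_homeomorphic _ _ X B
    (fun t => h ((gauge (L t))^-1 *: L t))) => //.
- apply: continuous_in_subspaceT => t; rewrite inE => Xt.
  apply: continuous_comp; last exact: ch.
  apply: continuous_scaleV; [by rewrite gt_eqF // gL| |exact: cL].
  by apply: continuous_comp; [exact: cL|exact: cgauge].
- by move=> t /unit[Cu gu]; exact: hB.
- move=> t t' Xt Xt' eqh; apply: Linj => //.
  have [Cu gu] := unit _ Xt; have [Cu' gu'] := unit _ Xt'.
  have [_ n2] := LC Xt; have [_ n2'] := LC Xt'.
  have [g0 g0'] := (gL _ Xt, gL _ Xt').
  have equ := hinj Cu Cu' gu gu' eqh.
  (* Both points of [X] have norm 2, so equal rescaled vectors force equal gauges. *)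
  have : \sum_l `|((gauge (L t))^-1 *: L t) 0 l| = \sum_l `|((gauge (L t'))^-1 *: L t') 0 l|.
    by rewrite equ.
  rewrite !norm1Z ?invr_gt0 // n2 n2' => /(mulIf _)-/(_ _)/invr_inj eqg.
  move: equ; rewrite eqg ?pnatr_eq0 // => /scalerI; apply.
  by rewrite invr_eq0 gt_eqF.
- move=> v /hsurj[w [Cw gw hw]].
  have w0 : w != 0.
    (* Homogeneity with factor 2 forces the gauge of 0 to be 0, not 1. *)
    apply/eqP => w0; have := @gaugeZ 2 w; rewrite w0 scaler0 -w0 gw => /(_ _); lra.
  have n0 : 0 < \sum_l `|w 0 l|.
    rewrite lt_neqAle sumr_ge0 // andbT eq_sym; apply: contraNneq w0 => s0.
    apply/eqP/rowP => l; apply/eqP; rewrite mxE -normr_eq0; apply/eqP.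
    exact: (psumr_eq0P (P := predT) (F := fun l => `|w 0 l|)).
  pose c := 2 / \sum_l `|w 0 l|.
  have c0 : 0 < c by rewrite divr_gt0.
  have [||t Xt Lt] := @Lsurj (c *: w); first exact: CZ.
    by rewrite norm1Z // divfK // gt_eqF.
  exists t => //; rewrite Lt gaugeZ // gw mulr1 scalerA mulVf ?scale1r //.
  by rewrite gt_eqF.
Qed.
End RadialProjection.
End Topology.

(** * Sections of cones by Euclidean gauges: the sphere and the ball *)

Section Gauges.
Import Order.TTheory GRing.Theory Num.Theory.
Local Open Scope classical_set_scope.
Local Open Scope ring_scope.
Variable R : realType.

Definition enorm k (v : 'rV[R]_k) : R := Num.sqrt (\sum_j v 0 j ^+ 2).

Lemma enorm_ge0 k (v : 'rV[R]_k) : 0 <= enorm v.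
Proof. exact: sqrtr_ge0. Qed.

Lemma sqr_enorm k (v : 'rV[R]_k) : enorm v ^+ 2 = \sum_j v 0 j ^+ 2.
Proof. by rewrite sqr_sqrtr // sumr_ge0 // => j _; exact: sqr_ge0. Qed.

Lemma enorm_eq0 k (v : 'rV[R]_k) : enorm v = 0 -> v = 0.
Proof.
move=> v0; have /eqP := sqr_enorm v; rewrite v0 expr0n /= eq_sym => /eqP sv.
apply/rowP => j; apply/eqP; rewrite mxE -sqrf_eq0; apply/eqP.
by apply: (psumr_eq0P (P := predT) (F := fun j => v 0 j ^+ 2)) => // l _; exact: sqr_ge0.
Qed.

Lemma enormZ k c (v : 'rV[R]_k) : 0 < c -> enorm (c *: v) = c * enorm v.
Proof.
move=> c0; rewrite /enorm (_ : \sum_j _ = c ^+ 2 * \sum_j v 0 j ^+ 2).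
  by rewrite sqrtrM ?sqr_ge0 // sqrtr_sqr gtr0_norm.
by rewrite mulr_sumr; apply: eq_bigr => j _; rewrite mxE exprMn.
Qed.

Lemma continuous_enorm k : continuous (@enorm k).
Proof.
move=> v; apply: continuous_comp; last exact: sqrt_continuous.
apply: continuous_sum => j {}v.
apply: (@continuous_comp _ _ _ (fun v : 'rV[R]_k => v 0 j) (fun x => x ^+ 2)).
  exact: coord_continuous.
exact: exprn_continuous.
Qed.

Section Sphere.
Variable k : nat.

(** A linear chart of the hyperplane of coordinate sum 0, where coordinate [ord0] is determined by
    the others. *)
Definition tail_row (w : 'rV[R]_k.+1) : 'rV[R]_k := \row_j w 0 (lift ord0 j).

Lemma tail_row_inj (w w' : 'rV[R]_k.+1) : \sum_l w 0 l = 0 -> \sum_l w' 0 l = 0 ->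
  tail_row w = tail_row w' -> w = w'.
Proof.
rewrite !big_ord_recl => s s' /rowP e.
have tl j : w 0 (lift ord0 j) = w' 0 (lift ord0 j) by have := e j; rewrite !mxE.
have st : \sum_j w 0 (lift ord0 j) = \sum_j w' 0 (lift ord0 j).
  by apply: eq_bigr => j _.
apply/rowP => l; case: (unliftP ord0 l) => [j|] -> //.
by lra.
Qed.

(** The cone is the whole hyperplane; with the Euclidean norm in the chart [tail_row] as gauge, its
    section is the unit sphere. *)
Lemma unit_sphere_homeomorphic q (X : set 'rV[R]_q) (L : 'rV[R]_q -> 'rV[R]_k.+1) :
  compact X -> continuous L ->
  (forall t, X t -> \sum_l L t 0 l = 0 /\ \sum_l `|L t 0 l| = 2) ->
  (forall t t', X t -> X t' -> L t = L t' -> t = t') ->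
  (forall w : 'rV[R]_k.+1, \sum_l w 0 l = 0 -> \sum_l `|w 0 l| = 2 -> exists2 t, X t & L t = w) ->
  homeomorphic X (@unit_sphere R k).
Proof.
move=> cX cL LC Linj Lsurj.
have tailZ c w : tail_row (c *: w) = c *: tail_row w by apply/rowP => j; rewrite !mxE.
have ct : continuous tail_row.
  move=> w; apply: continuous_at_rV => j.
  have -> : (fun v => tail_row v 0 j) = (fun v => v 0 (lift ord0 j)).
    by apply/funext => v; rewrite mxE.
  exact: coord_continuous.
apply: (@radial_homeomorphic R _ _ _ _ L [set w : 'rV[R]_k.+1 | \sum_l w 0 l = 0] _ tail_row
  (fun w => enorm (tail_row w))) => //=.
- by move=> w; apply: continuous_comp; [exact: ct|exact: continuous_enorm].
- move=> c w _ w0; under eq_bigr do rewrite mxE.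
  by rewrite -mulr_sumr w0 mulr0.
- by move=> c w c0; rewrite tailZ enormZ.
- move=> w w0 wn; rewrite lt_neqAle enorm_ge0 andbT eq_sym; apply: contraNneq wn.
  move=> /enorm_eq0 t0; apply/eqP; apply: tail_row_inj => //.
    by apply: big1 => l _; rewrite mxE.
  by rewrite t0; apply/rowP => j; rewrite !mxE.
- by move=> w _ e1; rewrite /unit_sphere /= -sqr_enorm e1 expr1n.
- by move=> w w' w0 w0' _ _; exact: tail_row_inj.
move=> v v1.
pose w : 'rV[R]_k.+1 := \row_l (if unlift ord0 l is Some j then v 0 j else - \sum_j v 0 j).
have wl j : w 0 (lift ord0 j) = v 0 j by rewrite mxE liftK.
have wv : tail_row w = v by apply/rowP => j; rewrite mxE wl.
exists w; rewrite wv; split=> //.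
  by rewrite big_ord_recl mxE unlift_none (eq_bigr _ (fun j _ => wl j)) addNr.
by rewrite /enorm (v1 : \sum_j v 0 j ^+ 2 = 1) sqrtr1.
Qed.
End Sphere.

Section Ball.
Variables (k : nat) (J : pred 'I_k.+2) (p : 'rV[R]_k.+2).
Let last : 'I_k.+2 := lift ord0 ord_max.
Let inner (j : 'I_k) : 'I_k.+2 := lift ord0 (widen_ord (leqnSn k) j).
Hypotheses (Jlast : J last) (p_neq0 : forall l, J l -> p 0 l != 0)
  (p_sum : \sum_l p 0 l = 0).

(* Along the interior direction [p], the cone [C] is the region above the graph
   [mu = 0]; shearing this graph flat maps the section onto a hemisphere, and
   [h], the projection along [p], maps the hemisphere onto the ball.  The
   coordinates [ord0] and [last] are recovered from [sum = 0] and [mu]. *)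
Let mu (w : 'rV[R]_k.+2) : R := \big[Num.min/w 0 last / p 0 last]_(l | J l) (w 0 l / p 0 l).

Let h (w : 'rV[R]_k.+2) : 'rV[R]_k :=
  \row_j (w 0 (inner j) - w 0 last / p 0 last * p 0 (inner j)).

(** On the cone both summands are nonnegative, and [gauge w = 1] means that the height [mu w] over
    the base point [h w] is [1 - enorm (h w)]. *)
Let gauge w := mu w + enorm (h w).

Let muZ c w : 0 < c -> mu (c *: w) = c * mu w.
Proof.
move=> c0; rewrite /mu (big_morph ( *%R c) (id1 := c * (w 0 last / p 0 last)) (op1 := Num.min)) //.
  by rewrite mxE mulrA; apply: eq_bigr => l _; rewrite mxE mulrA.
by move=> x y; rewrite minr_pMr // ltW.
Qed.

(** Adding [c *: p] raises every quotient by [c], the default value of the minimum included. *)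
Let muD c w : mu (w + c *: p) = mu w + c.
Proof.
rewrite /mu (big_morph (+%R^~ c) (id1 := w 0 last / p 0 last + c) (op1 := Num.min)) //.
  rewrite !mxE mulrDl mulfK ?p_neq0 //; apply: eq_bigr => l Jl.
  by rewrite !mxE mulrDl mulfK ?p_neq0.
by move=> x y; rewrite addr_minl.
Qed.

Let sum_split (w : 'rV[R]_k.+2) :
  \sum_l w 0 l = w 0 ord0 + (\sum_j w 0 (inner j) + w 0 last).
Proof. by rewrite big_ord_recl big_ord_recr. Qed.

Let sumD c (w : 'rV[R]_k.+2) : \sum_l (w + c *: p) 0 l = \sum_l w 0 l.
Proof.
under eq_bigr do rewrite !mxE.
by rewrite big_split /= -mulr_sumr p_sum mulr0 addr0.
Qed.

Let hD c w : h (w + c *: p) = h w.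
Proof.
apply/rowP => j; rewrite !mxE mulrDl mulfK ?p_neq0 //; ring.
Qed.

(** The multiple of [p] is chosen to match the coordinate [last]; equality under [h] then matches
    the inner coordinates, and the zero sums match [ord0]. *)
Let h_fiber (w w' : 'rV[R]_k.+2) : \sum_l w 0 l = 0 -> \sum_l w' 0 l = 0 -> h w = h w' ->
  w' = w + (w' 0 last / p 0 last - w 0 last / p 0 last) *: p.
Proof.
set c := (X in _ + X *: _) => s s' /rowP e.
have lastE : w' 0 last = (w + c *: p) 0 last.
  by rewrite !mxE mulrBl !divfK ?p_neq0 // addrC subrK.
have innerE j : w' 0 (inner j) = (w + c *: p) 0 (inner j).
  by have := e j; rewrite !mxE /c; lra.
have sc : \sum_l (w + c *: p) 0 l = 0.
  by rewrite sumD.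
move: s' sc; rewrite !sum_split lastE (eq_bigr _ (fun j _ => innerE j)) => s' sc.
apply/rowP => l; case: (unliftP ord0 l) => [l'|] ->; last by lra.
case: (unliftP ord_max l') => [j|] -> //.
rewrite (_ : lift ord0 _ = inner j) //; apply: val_inj => /=; congr bump.
by rewrite /bump leqNgt ltn_ord.
Qed.

(** By [Jlast] the default value of the minimum is itself one of the quotients. *)
Let mu_ge0P (w : 'rV[R]_k.+2) : 0 <= mu w <-> forall l, J l -> 0 <= w 0 l / p 0 l.
Proof.
split=> [m0 l Jl|h0]; first by apply: le_trans m0 _; exact: bigmin_le_cond.
by apply/bigmin_geP; split=> //; exact: h0.
Qed.

(** Over [v] the hyperplane contains a line in direction [p], along which [mu] grows at unit speed.
    The height [1 - enorm v] is attained exactly once, and it is nonnegative exactly when [v] lies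
    in the ball. *)
Lemma unit_ball_homeomorphic q (X : set 'rV[R]_q) (L : 'rV[R]_q -> 'rV[R]_k.+2) :
  let C (w : 'rV[R]_k.+2) := \sum_l w 0 l = 0 /\ (forall l, J l -> 0 <= w 0 l / p 0 l) in
  compact X -> continuous L ->
  (forall t, X t -> C (L t) /\ \sum_l `|L t 0 l| = 2) ->
  (forall t t', X t -> X t' -> L t = L t' -> t = t') ->
  (forall w, C w -> \sum_l `|w 0 l| = 2 -> exists2 t, X t & L t = w) ->
  homeomorphic X (@unit_ball R k).
Proof.
move=> C cX cL LC Linj Lsurj.
have cdiv l : continuous (fun w : 'rV[R]_k.+2 => w 0 l / p 0 l).
  by apply: continuous_mulrC; exact: coord_continuous.
have ch : continuous h.
  move=> w; apply: continuous_at_rV => j.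
  have -> : (fun v => h v 0 j) =
      (fun v => v 0 (inner j) - v 0 last / p 0 last * p 0 (inner j)).
    by apply/funext => v; rewrite mxE.
  apply: continuous_subr; first exact: coord_continuous.
  by apply: continuous_mulrC; exact: cdiv.
have hZ c w : h (c *: w) = c *: h w by apply/rowP => j; rewrite !mxE; ring.
apply: (@radial_homeomorphic R _ _ _ _ L C _ h gauge) => //.
- apply: continuous_addr; first exact: continuous_bigmin.
  by move=> w; apply: continuous_comp; [exact: ch|exact: continuous_enorm].
- move=> c w c0 [w0 wJ]; split; last by move=> l Jl; rewrite mxE -mulrA mulr_ge0 ?wJ // ltW.
  by under eq_bigr do rewrite mxE; rewrite -mulr_sumr w0 mulr0.
- by move=> c w c0; rewrite /gauge hZ enormZ // muZ // mulrDr.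
- move=> w [w0 /mu_ge0P m0] wn; have e0 := enorm_ge0 (h w).
  rewrite lt_neqAle addr_ge0 // andbT eq_sym; apply: contraNneq wn => g0.
  have [mz /enorm_eq0 hz] : mu w = 0 /\ enorm (h w) = 0 by move: g0; rewrite /gauge; lra.
  have s0 : \sum_l (0 : 'rV[R]_k.+2) 0 l = 0 by apply: big1 => l _; rewrite mxE.
  have h0 : h 0 = h w by rewrite hz; apply/rowP => j; rewrite !mxE; ring.
  (* Since [h w = 0], the vector [w] is a multiple of [p], and [mu w = 0] is the factor. *)
  have wE := h_fiber s0 w0 h0; move: mz; rewrite wE muD.
  have -> : mu 0 = 0.
    by have := @muZ 2 0; rewrite scaler0 => /(_ (ltr0Sn _ _)); lra.
  by rewrite add0r => ->; rewrite scale0r addr0.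
- move=> w [_ /mu_ge0P m0] g1; rewrite /unit_ball /= -sqr_enorm.
  by apply: exprn_ile1; [exact: enorm_ge0|move: g1; rewrite /gauge; lra].
- move=> w w' [w0 _] [w0' _] g1 g1' eh; have wE := h_fiber w0 w0' eh.
  have mE := muD (w' 0 last / p 0 last - w 0 last / p 0 last) w; rewrite -wE in mE.
  have c0 : w' 0 last / p 0 last - w 0 last / p 0 last = 0.
    by move: g1 g1'; rewrite /gauge eh mE; lra.
  by rewrite wE c0 scale0r addr0.
move=> v v1.
(* A lift of [v] to the hyperplane with coordinate [last] equal to 0, so that [h u = v]. *)
pose u : 'rV[R]_k.+2 := \row_l (if unlift ord0 l is Some l' then
   if unlift ord_max l' is Some j then v 0 j else 0 else - \sum_j v 0 j).
have u_last : u 0 last = 0 by rewrite mxE liftK unlift_none.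
have u_inner j : u 0 (inner j) = v 0 j.
  rewrite mxE liftK (_ : widen_ord _ j = lift ord_max j) ?liftK //.
  by apply: val_inj; rewrite /= /bump leqNgt ltn_ord.
have hu : h u = v by apply/rowP => j; rewrite mxE u_last u_inner !mul0r subr0.
have ev : enorm v <= 1.
  by rewrite -(ler_pXn2r (n := 2)) ?nnegrE ?enorm_ge0 // sqr_enorm expr1n.
(* Moving along [p] adjusts the height to [1 - enorm v] without changing [h]. *)
exists (u + (1 - enorm v - mu u) *: p); split.
- split; last by apply/mu_ge0P; rewrite muD; lra.
  have su : \sum_l u 0 l = 0.
    rewrite sum_split u_last mxE unlift_none addr0.
    by under [X in _ + X]eq_bigr do rewrite u_inner; rewrite addNr.
  by rewrite sumD.
- by rewrite /gauge muD hD hu; lra.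
- by rewrite hD.
Qed.
End Ball.
End Gauges.

(** * Compactness and the topological type of the complex *)

Section Complex.
Import Order.TTheory GRing.Theory Num.Theory.
Local Open Scope classical_set_scope.
Local Open Scope ring_scope.
Variables (R : realType) (m n i : nat) (r : 'I_m * 'I_n -> nat).
Hypotheses (m0 : (0 < m)%N) (im : (i <= m)%N) (mn : (m <= n)%N).
Hypotheses (rinj : injective r)
  (rcone : forall x y, is_cone_var i x -> ~~ is_cone_var i y -> (r x < r y)%N).

Lemma continuous_entry x : continuous (fun t => @entry R m n t x).
Proof. exact: coord_continuous. Qed.

(** The realization is a closed subset of a cube: noncrossing support becomes the vanishing of the
    product of entries over each crossing pair. *)
Lemma revlex_minus_cone_compact : compact (@revlex_minus_cone R m n i r).
Proof.
have cube : compact [set t : 'rV[R]_#|{: 'I_m * 'I_n}| | forall k, `[0, 1]%classic (t 0 k)].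
  by apply: (@rV_compact _ _ (fun=> `[0 : R, 1]%classic)) => k; exact: segment_compact.
apply: subclosed_compact cube _; last first.
  move=> t /(revlex_minus_coneP _ m0 mn rinj _)[t0 t1 _ _] k.
  rewrite /= in_itv /= -[k]enum_valK [X in X && _](t0 _) /= -t1.
  by rewrite (bigD1 (enum_val k)) //= lerDl sumr_ge0.
pose crossing (z : ('I_m * 'I_n) * ('I_m * 'I_n)) :=
  (r (z.1.1, z.2.2) < r z.1)%N /\ (r (z.1.1, z.2.2) < r z.2)%N.
rewrite (_ : revlex_minus_cone i r =
  (\bigcap_x [set t | 0 <= entry t x]) `&`
  [set t | \sum_x entry t x = 1] `&`
  (\bigcap_(z in crossing) [set t | entry t z.1 * entry t z.2 = 0]) `&`
  (\bigcap_(x in is_cone_var i) [set t | entry t x = 0])); last first.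
  apply/seteqP; split=> t.
    move=> /(revlex_minus_coneP _ m0 mn rinj _)[t0 t1 nc tc].
    split; last by move=> x; exact: tc.
    split; first by split=> // x _; exact: t0.
    move=> [[a b'] [a' b]] [/= lt1 lt2]; apply/eqP; rewrite mulf_eq0.
    by apply/norP => -[h1 h2]; exact: nc h1 h2 lt1 lt2.
  move=> [[[t0 t1] nc] tc]; apply/(revlex_minus_coneP _ m0 mn rinj _); split=> //.
  - by move=> x; exact: t0.
  - move=> a b a' b' h1 h2 lt1 lt2.
    have /eqP := nc ((a, b'), (a', b)) (conj lt1 lt2).
    by rewrite mulf_eq0 (negPf h1) (negPf h2).
have ce := continuous_entry.
have cl (f : 'rV[R]_#|{: 'I_m * 'I_n}| -> R) (D : set R) :
  continuous f -> closed D -> closed (f @^-1` D) by move=> /continuous_closedP; exact.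
repeat apply: closedI.
- by apply: closed_bigI => x _; apply: (cl _ [set y | 0 <= y] (ce x)); exact: closed_ge.
- apply: (cl _ [set y | y = 1]); last exact: closed_eq.
  exact: (continuous_sum ce).
- apply: closed_bigI => z _; apply: (cl _ [set y | y = 0]); last exact: closed_eq.
  by move=> t; apply: continuousM; exact: ce.
- by apply: closed_bigI => x _; apply: (cl _ [set y | y = 0] (ce x)); exact: closed_eq.
Qed.

Lemma continuous_difference_coord N : continuous (@difference_coord R m n i N).
Proof.
move=> t; apply: continuous_at_rV => l.
have -> : (fun t => @difference_coord R m n i N t 0 l) =
    (fun t => row_mass t l - col_mass i t l).
  by apply/funext => u; rewrite mxE.
by apply: continuous_subr; apply: continuous_sum => x;
  apply: continuous_mulrC; exact: continuous_entry.
Qed.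

(** Sign conditions occur exactly at the coordinates from [i] on, collected in [J]. Dividing by the
    entries of an interior direction [p] turns them all into nonnegativity. *)
Lemma revlex_minus_cone_ball k : (m + n = k.+2 + i)%N -> (i < n)%N ->
  homeomorphic (@revlex_minus_cone R m n i r) (@unit_ball R k).
Proof.
move=> hN i_n.
(* The margins of the all-ones matrix: [n] at coordinates of rows only, [-m] at coordinates of
   columns only, with total 0. *)
pose p := @difference_coord R m n i k.+2 (const_mx 1).
have entry1 x : @entry R m n (const_mx 1) x = 1 by rewrite /entry mxE.
have p_pos (l : 'I_k.+2) : (i <= l < m)%N -> 0 < p 0 l.
  move=> lim; rewrite mxE col_mass_out // subr0; case/andP: (lim) => _ lm.
  rewrite (row_massE _ (Ordinal lm)) (eq_bigr _ (fun b _ => entry1 _)).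
  by rewrite sumr_const card_ord ltr0n; lia.
have p_neg (l : 'I_k.+2) : (m <= l)%N -> p 0 l < 0.
  move=> ml; rewrite mxE row_mass_out // sub0r oppr_lt0.
  have [|b bl] := col_coord_surj m0 im mn hN (ltn_ord l); first by rewrite ltnNge ml andbF.
  rewrite -bl col_massE (eq_bigr _ (fun a _ => entry1 _)).
  by rewrite sumr_const card_ord ltr0n.
pose J := [pred l : 'I_k.+2 | (i <= l)%N].
have ratio (w : R) (l : 'I_k.+2) : J l ->
   (0 <= w / p 0 l) = (if (l < m)%N then 0 <= w else w <= 0).
  move=> il; have [ml|lm] := leqP m l.
    by rewrite ler_ndivlMr ?p_neg // mul0r.
  by rewrite ler_pdivlMr ?mul0r // p_pos // lm andbT.
apply: (@unit_ball_homeomorphic R k J p _ _ _ _ _ (difference_coord i k.+2)).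
- by rewrite /J /= /bump /=; lia.
- move=> l il; have [ml|lm] := leqP m l; first by rewrite lt_eqF ?p_neg.
  by rewrite gt_eqF // p_pos // lm andbT.
- under eq_bigr do rewrite mxE.
  by rewrite sumrB (sum_row_mass m0 im mn hN) (sum_col_mass m0 im mn hN) subrr.
- exact: revlex_minus_cone_compact.
- exact: continuous_difference_coord.
- move=> t /(difference_coord_sphere m0 im mn rinj rcone hN)[w0 w2 wx wy].
  split=> //; split=> // l il; rewrite ratio //; have [ml|lm] := leqP m l; first exact: wy.
  by apply: wx; rewrite lm andbT.
- exact: (difference_coord_inj m0 im mn rinj rcone hN).
move=> w [w0 wJ] w2.
apply: (difference_coord_surj m0 im mn rinj hN); split=> // l.
  by move=> /andP[il lm]; have := wJ l il; rewrite ratio // lm.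
by move=> ml; have := wJ l (leq_trans im ml); rewrite ratio ?ltnNge ?ml // /J /= (leq_trans im).
Qed.

(** All [m] coordinates are shared by a row and a column, so the sign conditions are vacuous and the
    cone is the whole hyperplane. For [k = 0] both sets are empty. *)
Lemma revlex_minus_cone_sphere k : (m = k.+1)%N -> i = m -> m = n ->
  homeomorphic (@revlex_minus_cone R m n i r) (@unit_sphere R k).
Proof.
move=> hm eim emn.
have hN : (m + n = k.+1 + i)%N by lia.
apply: (@unit_sphere_homeomorphic R k _ _ (difference_coord i k.+1)).
- exact: revlex_minus_cone_compact.
- exact: continuous_difference_coord.
- by move=> t /(difference_coord_sphere m0 im mn rinj rcone hN)[].
- exact: (difference_coord_inj m0 im mn rinj rcone hN).
move=> w w0 w2.
apply: (difference_coord_surj m0 im mn rinj hN); split=> // l; first by lia.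
by have := ltn_ord l; lia.
Qed.
End Complex.

Unset Implicit Arguments.

Theorem theorem4p13 (R : realType) (m n i : nat) (r : 'I_m * 'I_n -> nat) :
  (1 <= m)%N -> (i <= m)%N -> (m <= n)%N ->
  injective r ->
  (forall x y, is_cone_var i x -> is_cone_var i y ->
     (nat_of_ord x.1 < nat_of_ord y.1)%N -> (r x < r y)%N) ->
  (forall x y, is_cone_var i x -> ~~ is_cone_var i y -> (r x < r y)%N) ->
  (((m < n)%N \/ (m = n /\ (i < m)%N)) ->
     homeomorphic (@revlex_minus_cone R m n i r) (@unit_ball R (m + n - i - 2))) /\
  ((i = m /\ m = n) ->
     homeomorphic (@revlex_minus_cone R m n i r) (@unit_sphere R (n - 1))).
Proof.
move=> m0 im mn rinj _ rcone; split=> [hball|[eim emn]].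
  (* Both alternatives of the hypothesis give [i < n]. *)
  by apply: revlex_minus_cone_ball => //; lia.
by apply: revlex_minus_cone_sphere => //; lia.
Qed.
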